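(* Let $G=(V,E)$ be a graph and $x\in V$ a vertex of degree $d=d_1+d_2$. Let $\tilde G=(\tilde V,\tilde E)$ be the graph obtained by splitting $x$ into two non-adjacent vertices $x_1,x_2$, where $x_1$ is adjacent to $d_1$ neighbours of $x$ and $x_2$ is adjacent to the other $d_2$ neighbours of $x$ (all other vertices and edges being unchanged). Then $$\nu(G)\ge\nu(\tilde G).$$
   Context: All graphs $G=(V,E)$ are finite and simple; $x\sim y$ denotes adjacency. $E^{or}(G)$ is the set of ordered pairs $(x,y)$ with $x\sim y$. A magnetic potential is a map $\sigma:E^{or}(G)\to S^1=\{z\in\mathbb{C}:|z|=1\}$ with $\sigma(y,x)=\sigma(x,y)^{-1}$. The magnetic Laplacian on functions $f:V\to\mathbb{C}$ is $\Delta^\sigma f(x)=\sum_{y\sim x}(f(x)-\sigma(x,y)f(y))$, and $\lambda_1^\sigma(G)$ is its smallest eigenvalue. The magneto-spectral height is $\nu(G)=\sup_\sigma\lambda_1^\sigma(G)$, over all magnetic potentials on $G$. *)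

(* Defs.v *)
From HB Require Import structures.
From mathcomp Require Import all_boot all_order all_algebra.
From mathcomp Require Import all_classical reals.
From mathcomp Require Import complex.

Set Implicit Arguments.
Unset Strict Implicit.
Unset Printing Implicit Defensive.

Import Order.TTheory GRing.Theory Num.Theory.

Local Open Scope ring_scope.
Local Open Scope complex_scope.

Record graph := Graph {
  vertex :> finType;
  adj : rel vertex;
  adj_sym : symmetric adj;
  adj_irr : irreflexive adj
}.

Definition neighbours (G : graph) (x : G) : {set G} :=
  [set y | adj x y].

Definition degree (G : graph) (x : G) : nat := #|neighbours x|.

Section Magnetic.
Variables (R : realType) (G : graph).

(* Potentials are total functions constrained only on adjacent pairs: the
   values at other pairs do not enter the Laplacian. *)
Definition magnetic_potential (s : G -> G -> R[i]) : Prop :=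
  forall x y : G, adj x y -> `|s x y| = 1 /\ s y x = (s x y)^-1.

Definition magnetic_laplacian (s : G -> G -> R[i])
    (f : {ffun G -> R[i]^o}) : {ffun G -> R[i]^o} :=
  [ffun x => \sum_(y | adj x y) (f x - s x y * f y)].

Fact magnetic_laplacian_is_linear (s : G -> G -> R[i]) :
  linear (magnetic_laplacian s).
Proof.
move=> a f g; apply/ffunP => x; rewrite !ffunE.
rewrite scaler_sumr -big_split /=; apply: eq_bigr => y _.
by rewrite !ffunE mulrDr scalerBr /GRing.scale /= mulrCA opprD addrACA.
Qed.

HB.instance Definition _ (s : G -> G -> R[i]) :=
  GRing.isLinear.Build R[i] {ffun G -> R[i]^o} {ffun G -> R[i]^o} _
    (magnetic_laplacian s) (magnetic_laplacian_is_linear s).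

(* The Laplacian of a magnetic potential is self-adjoint, so all its complex
   eigenvalues are real; for nonempty [G] they form a nonempty finite set, and
   the infimum is a minimum. *)
Definition lambda1 (s : G -> G -> R[i]) : R :=
  inf [set l : R |
    passmx.leigenvalue (linfun (magnetic_laplacian s)) l%:C]%classic.

Definition magneto_spectral_height : R :=
  sup [set lambda1 s | s in magnetic_potential]%classic.

Lemma leigenvalue_laplacianP (s : G -> G -> R[i]) (a : R[i]) :
  passmx.leigenvalue (linfun (magnetic_laplacian s)) a <->
  exists2 f : {ffun G -> R[i]^o}, f != 0 & magnetic_laplacian s f = a *: f.
Proof.
have kerE f : (f \in passmx.leigenspace (linfun (magnetic_laplacian s)) a) =
              (magnetic_laplacian s f == a *: f).
  rewrite memv_ker add_lfunE opp_lfunE scale_lfunE id_lfunE lfunE /=.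
  by rewrite subr_eq0.
split=> [h | [f f0 fE]].
  exists (vpick (passmx.leigenspace (linfun (magnetic_laplacian s)) a)).
    by rewrite vpick0.
  by apply/eqP; rewrite -kerE memv_pick.
apply: contraNneq f0 => k0.
by rewrite -memv0 -k0 kerE fE.
Qed.

End Magnetic.

Section Split.
Variables (G : graph) (x : G) (N1 N2 : {set G}).

(* [inl v] is the vertex [v] of [G] other than [x]; [inr true] and [inr false]
   are the two copies [x1] and [x2], with neighbourhoods [N1] and [N2]. *)
Definition split_vertex : finType := ({v : G | v != x} + bool)%type.

Definition split_nbhd (b : bool) : {set G} := if b then N1 else N2.

Definition split_adj (u v : split_vertex) : bool :=
  match u, v with
  | inl u', inl v' => adj (val u') (val v')
  | inl u', inr b => val u' \in split_nbhd b
  | inr b, inl v' => val v' \in split_nbhd b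
  | inr _, inr _ => false
  end.

Fact split_adj_sym : symmetric split_adj.
Proof. by move=> [u|b] [v|c] //=; apply: adj_sym. Qed.

Fact split_adj_irr : irreflexive split_adj.
Proof. by move=> [u|b] //=; apply: adj_irr. Qed.

Definition split_graph : graph := Graph split_adj_sym split_adj_irr.

End Split.

(* Main.v *)
From HB Require Import structures.
Require Import Defs.
From mathcomp Require Import all_boot all_order all_algebra.
From mathcomp Require Import all_classical reals.
From mathcomp Require Import complex spectral.
From mathcomp Require Import ring.

Set Implicit Arguments.
Unset Strict Implicit.
Unset Printing Implicit Defensive.

Import Order.TTheory GRing.Theory Num.Theory.

Local Open Scope ring_scope.
Local Open Scope sesquilinear_scope.

(** Gluing [x1] and [x2] back together is a map from the split graph onto [G]
    which is a bijection on edges. Hence every potential [s] on the split graph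
    can be carried over to [G] edge by edge, and a function [f] on [G], pulled
    back to the split graph, keeps its magnetic energy: the energy
    [\sum_(y ~ x) |f x - s x y * f y|^2] is a sum over edges and sees only the
    values at their ends. Its norm, on the other hand, can only grow, because
    [|f x|^2] is now counted twice. As energies are nonnegative, every Rayleigh
    quotient of [f] on [G] is at least that of its pullback, hence at least
    [lambda1 s]; so the potential carried over to [G] has a [lambda1] which is
    at least as large ([lambda1_push]).

    Passing between [lambda1], an infimum of eigenvalues, and Rayleigh
    quotients requires the variational principle ([lambda1_rayleigh] and
    [lambda1_greatest]). It follows from the diagonalization of self-adjoint
    operators ([self_adjoint_diagonal]), the Laplacian being self-adjoint and
    nonnegative by the energy formula [hdot_laplacian]. Finally, comparing the
    two suprema over potentials requires that of [G] to be bounded, which is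
    what [lambda1_le_degree] gives.

    The argument works for every map of graphs that is surjective on vertices
    and bijective on edges ([magneto_spectral_height_fold]). *)

(** * Diagonalization of self-adjoint operators on functions *)

Section SelfAdjoint.
Variables (C : numClosedFieldType) (I : finType).
Implicit Types f g : {ffun I -> C^o}.

Definition hdot f g : C := \sum_i f i * (g i)^*.

Lemma hdot_ge0 f : 0 <= hdot f f.
Proof. by apply: sumr_ge0 => i _; rewrite mul_conjC_ge0. Qed.

Lemma hdot_gt0 f : f != 0 -> 0 < hdot f f.
Proof.
move=> f0; rewrite lt0r hdot_ge0 andbT; apply: contraNneq f0 => /eqP.
rewrite psumr_eq0 => [/allP z|i _]; last by rewrite mul_conjC_ge0.
apply/eqP/ffunP => i; rewrite ffunE; apply/eqP.
by rewrite -mul_conjC_eq0; exact: z (mem_index_enum i).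
Qed.

Lemma hdotZl a f g : hdot (a *: f) g = a * hdot f g.
Proof. by rewrite mulr_sumr; apply: eq_bigr => i _; rewrite ffunE mulrA. Qed.

Lemma hdotC f g : (hdot f g)^* = hdot g f.
Proof.
by rewrite rmorph_sum; apply: eq_bigr => i _; rewrite rmorphM /= conjCK mulrC.
Qed.

Let row_of f : 'rV[C]_#|I| := \row_k f (enum_val k).
Let ffun_of (v : 'rV[C]_#|I|) : {ffun I -> C^o} :=
  [ffun i => v 0 (enum_rank i)].

Let row_ofK : cancel row_of ffun_of.
Proof. by move=> f; apply/ffunP => i; rewrite ffunE mxE enum_rankK. Qed.

Let ffun_ofK : cancel ffun_of row_of.
Proof. by move=> v; apply/rowP => k; rewrite mxE ffunE enum_valK. Qed.

Let hdotE f g : hdot f g = (row_of f *m (row_of g) ^t*) 0 0.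
Proof.
rewrite mxE /hdot (reindex _ (onW_bij _ (enum_val_bij I))) /=.
by apply: eq_bigr => k _; rewrite !mxE.
Qed.

(** The spectral theorem for [T], in the form that Rayleigh quotients need:
    [c k] is the squared modulus of the [k]-th coordinate of [f] in an
    orthonormal basis of eigenvectors [e], so both quadratic forms become
    weighted sums of the [c k]. *)
Theorem self_adjoint_diagonal
    (T : {linear {ffun I -> C^o} -> {ffun I -> C^o}}) :
  (forall f g, hdot (T f) g = hdot f (T g)) ->
  exists (e : 'I_#|I| -> {ffun I -> C^o}) (d : 'I_#|I| -> C),
    (forall k, e k != 0 /\ T (e k) = d k *: e k) /\
    (forall f, exists c : 'I_#|I| -> C,
      [/\ forall k, 0 <= c k, hdot f f = \sum_k c k
        & hdot (T f) f = \sum_k d k * c k]).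
Proof.
move=> Tsa.
have row_lin : linear ((row_of \o T \o ffun_of) : _ -> _).
  move=> a u v; rewrite /=.
  have -> : ffun_of (a *: u + v) = a *: ffun_of u + ffun_of v.
    by apply/ffunP => i; rewrite !ffunE !mxE.
  by rewrite linearP; apply/rowP => k; rewrite !mxE !ffunE.
pose F : {linear _ -> _} := HB.pack (row_of \o T \o ffun_of)
  (GRing.isLinear.Build _ _ _ _ _ row_lin).
have [A TE] : exists A, forall f, row_of (T f) = row_of f *m A.
  by exists (lin1_mx F) => f; rewrite mul_rV_lin1 /= row_ofK.
(* Testing self-adjointness on the canonical basis compares single entries. *)
have Aherm : A ^t* = A.
  have dotA (u v : 'rV_#|I|) :
      (u *m A *m v ^t*) 0 0 = (u *m (v *m A) ^t*) 0 0.
    by rewrite -[u]ffun_ofK -[v]ffun_ofK -!TE -!hdotE.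
  apply/matrixP => i j.
  have := dotA (delta_mx 0 i) (delta_mx 0 j).
  rewrite -!rowE => e.
  have dE (M : 'rV_#|I|) k : (M *m (delta_mx 0 k) ^t*) 0 0 = M 0 k.
    rewrite mxE (bigD1 k) //= !mxE !eqxx conjC1 mulr1 big1 ?addr0 // => l lk.
    by rewrite !mxE (negPf lk) andbF conjC0 mulr0.
  by move: e; rewrite dE !mxE => ->.
have /orthomx_spectralP : A \is normalmx by apply/normalmxP; rewrite Aherm.
set P := spectralmx A; set D := spectral_diag A => AE.
have Pu : P \is unitarymx by exact: spectral_unitarymx.
have Punit : P \in unitmx by exact: unitarymx_unit.
(* With row vectors the operator acts on the right, so the eigenvectors are
   the rows of [P]. *)
exists (fun k => ffun_of (row k P)), (fun k => D 0 k); split=> [k|f].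
  split.
    apply/eqP => /(congr1 row_of); rewrite ffun_ofK => Pk0.
    have := congr1 (mulmx^~ (invmx P)) Pk0; rewrite -row_mul mulmxV //.
    have -> : row_of 0 = 0 by apply/rowP => j; rewrite !mxE ffunE.
    rewrite mul0mx => /rowP/(_ k); rewrite !mxE eqxx => /eqP.
    by rewrite oner_eq0.
  apply: (can_inj row_ofK); rewrite TE ffun_ofK {1}AE !mulmxA.
  rewrite -row_mul mulmxV // -row_mul mul1mx row_diag_mx -scalemxAl -rowE.
  by apply/rowP => j; rewrite !mxE !ffunE !mxE enum_valK.
pose w := row_of f *m invmx P.
have fE : row_of f = w *m P by rewrite mulmxKV.
exists (fun k => w 0 k * (w 0 k)^*); split=> [k||].
- exact: mul_conjC_ge0.
- rewrite hdotE fE trmx_mul map_mxM mulmxA -(mulmxA w) (unitarymxP Pu) mulmx1.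
  by rewrite mxE; apply: eq_bigr => k _; rewrite !mxE.
- rewrite hdotE TE fE trmx_mul map_mxM mulmxA AE !mulmxA mulmxK //.
  rewrite -(mulmxA _ P) (unitarymxP Pu) mulmx1 mxE.
  apply: eq_bigr => k _; rewrite mul_mx_diag !mxE.
  by rewrite mulrA [D 0 k * _]mulrC.
Qed.

End SelfAdjoint.

(** * Magnetic energy and the variational principle *)

Section MagneticEnergy.
Variables (R : realType) (G : graph) (s : G -> G -> R[i]).
Hypothesis s_pot : magnetic_potential s.
Implicit Types f g : {ffun G -> R[i]^o}.

Definition energy f g : R[i] :=
  \sum_x \sum_(y | adj x y) (f x - s x y * f y) * (g x - s x y * g y)^*.

Lemma energy_ge0 f : 0 <= energy f f.
Proof. by do 2!apply: sumr_ge0 => ? _; exact: mul_conjC_ge0. Qed.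

(** Green's formula. Reversing the edge [x y] and multiplying by
    [s x y * s y x = 1] moves the conjugate factor from [g x] to
    [- s x y * g y]; adding the two expressions makes [energy], in which each
    edge is counted in both directions, whence the factor 2. *)
Lemma hdot_laplacian f g :
  hdot (magnetic_laplacian s f) g *+ 2 = energy f g.
Proof.
have dotE : hdot (magnetic_laplacian s f) g =
    \sum_x \sum_(y | adj x y) (f x - s x y * f y) * (g x)^*.
  by apply: eq_bigr => x _; rewrite ffunE mulr_suml.
have dotE' : hdot (magnetic_laplacian s f) g =
    - \sum_x \sum_(y | adj x y) (f x - s x y * f y) * (s x y * g y)^*.
  rewrite dotE (exchange_big_dep xpredT) //= -sumrN; apply: eq_bigr => x _.
  under eq_bigl do rewrite adj_sym.
  rewrite -sumrN; apply: eq_bigr => y xy.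
  have [s1 ->] := s_pot xy.
  have s0 : s x y != 0 by rewrite -normr_gt0 s1.
  have sV : (s x y)^* = (s x y)^-1 by rewrite invC_norm s1 expr1n invr1 mul1r.
  by rewrite rmorphM /= sV; field.
rewrite mulr2n {1}dotE dotE' -sumrB; apply: eq_bigr => x _.
rewrite -sumrB; apply: eq_bigr => y _.
by rewrite rmorphB mulrBr.
Qed.

Lemma laplacian_self_adjoint f g :
  hdot (magnetic_laplacian s f) g = hdot f (magnetic_laplacian s g).
Proof.
have energyC : (energy g f)^* = energy f g.
  rewrite rmorph_sum; apply: eq_bigr => x _; rewrite rmorph_sum.
  by apply: eq_bigr => y _; rewrite rmorphM /= conjCK mulrC.
apply: (pmulrnI (ltn0Sn 1)); rewrite /= hdot_laplacian -energyC.
by rewrite -hdot_laplacian rmorphMn /= hdotC.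
Qed.

Lemma laplacian_ge0 f : 0 <= hdot (magnetic_laplacian s f) f.
Proof. by rewrite -(pmulrn_lge0 _ (ltn0Sn 1)) hdot_laplacian energy_ge0. Qed.

Lemma laplacian_eigenvalue_ge0 (a : R[i]) f :
  f != 0 -> magnetic_laplacian s f = a *: f -> 0 <= a.
Proof.
move=> /hdot_gt0 f0 fE; have := laplacian_ge0 f.
by rewrite fE hdotZl pmulr_lge0.
Qed.

Lemma lambda1_le (l : R) f :
  f != 0 -> magnetic_laplacian s f = l%:C%C *: f -> lambda1 s <= l.
Proof.
move=> f0 fE; apply: ge_inf; last by apply/leigenvalue_laplacianP; exists f.
exists 0 => m /leigenvalue_laplacianP [g g0 gE].
by rewrite -ler0c (laplacian_eigenvalue_ge0 g0 gE).
Qed.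

Lemma lambda1_ge0 : 0 <= lambda1 s.
Proof.
rewrite /lambda1; set E := [set _ | _]%classic.
have [->|E0] := eqVneq E set0; first by rewrite inf0.
apply: lb_le_inf => [|m /leigenvalue_laplacianP [g g0 gE]].
  exact/set0P.
by rewrite -ler0c (laplacian_eigenvalue_ge0 g0 gE).
Qed.

(** In an eigenbasis this is termwise: each eigenvalue is nonnegative, hence
    real, hence at least the infimum [lambda1 s]. *)
Lemma lambda1_rayleigh f :
  (lambda1 s)%:C%C * hdot f f <= hdot (magnetic_laplacian s f) f.
Proof.
have [e [d [eP /(_ f) [c [c0 -> ->]]]]] :=
  self_adjoint_diagonal laplacian_self_adjoint.
rewrite mulr_sumr ler_sum // => k _; rewrite ler_wpM2r //.
have [ek0 ekE] := eP k; have dk0 := laplacian_eigenvalue_ge0 ek0 ekE.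
have dkE : d k = (complex.Re (d k))%:C%C by rewrite RRe_real // ger0_real.
by rewrite dkE lecR; apply: (lambda1_le ek0); rewrite -dkE.
Qed.

(** Each eigenvalue is the Rayleigh quotient of its eigenvector. The vertex
    [x0] provides an eigenvalue: on an empty set of eigenvalues the infimum
    would be the default value 0. *)
Lemma lambda1_greatest (x0 : G) (c : R) :
  (forall f, c%:C%C * hdot f f <= hdot (magnetic_laplacian s f) f) ->
  c <= lambda1 s.
Proof.
move=> cP; apply: lb_le_inf => [|l /leigenvalue_laplacianP [f f0 fE]].
  have [e [d [eP _]]] := self_adjoint_diagonal laplacian_self_adjoint.
  have [ek0 ekE] := eP (enum_rank x0); set k := enum_rank x0 in ek0 ekE *.
  exists (complex.Re (d k)); apply/leigenvalue_laplacianP; exists (e k) => //.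
  by rewrite RRe_real // ger0_real // (laplacian_eigenvalue_ge0 ek0 ekE).
by have := cP f; rewrite fE hdotZl ler_pM2r ?hdot_gt0 // lecR.
Qed.

(** The Rayleigh quotient of the indicator function of [x] is the degree
    of [x]. *)
Lemma lambda1_le_degree (x : G) : lambda1 s <= (degree x)%:R.
Proof.
pose f : {ffun G -> R[i]^o} := [ffun y => (y == x)%:R].
have := lambda1_rayleigh f.
have -> : hdot f f = 1.
  rewrite /hdot (bigD1 x) //= ffunE eqxx conjC1 mulr1 big1 ?addr0 // => y yx.
  by rewrite ffunE (negPf yx) mul0r.
have -> : hdot (magnetic_laplacian s f) f = ((degree x)%:R)%:C%C.
  rewrite /hdot (bigD1 x) //= big1 ?addr0 => [|y yx]; last first.
    by rewrite [f y]ffunE (negPf yx) conjC0 mulr0.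
  rewrite [f x]ffunE eqxx conjC1 mulr1 ffunE rmorph_nat /degree -sum1_card.
  rewrite natr_sum; apply: eq_big => [y|y xy]; first by rewrite inE.
  rewrite !ffunE eqxx; case: eqP xy => [->|_ _]; first by rewrite adj_irr.
  by rewrite mulr0 subr0.
by rewrite mulr1 lecR.
Qed.

End MagneticEnergy.

(** * Maps of graphs that are bijective on edges *)

(** The edge [u v] of [G] lifts to the edge of [H] from [lift_end u v] to
    [lift_end v u], so the hypotheses say that [fold] is bijective on directed
    edges. Asking [lift_endK] of all pairs, adjacent or not, also makes [fold]
    surjective on vertices. *)
Section Folding.
Variables (R : realType) (H G : graph) (fold : H -> G) (lift_end : G -> G -> H).
Hypothesis lift_endK : forall u v, fold (lift_end u v) = u.
Hypothesis fold_adj : forall a b : H, adj a b -> adj (fold a) (fold b).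
Hypothesis lift_end_fold : forall a b : H,
  adj a b -> lift_end (fold a) (fold b) = a.
Hypothesis lift_end_adj : forall u v : G,
  adj u v -> adj (lift_end u v) (lift_end v u).

Definition push_potential (s : H -> H -> R[i]) (u v : G) : R[i] :=
  s (lift_end u v) (lift_end v u).

Lemma push_potentialP s :
  magnetic_potential s -> magnetic_potential (push_potential s).
Proof. by move=> s_pot u v uv; apply: s_pot (lift_end_adj uv). Qed.

Definition pullback (f : {ffun G -> R[i]^o}) : {ffun H -> R[i]^o} :=
  [ffun a => f (fold a)].

(** Both energies are sums over directed edges, matched by [lift_end]. *)
Lemma energy_pullback s f :
  energy s (pullback f) (pullback f) = energy (push_potential s) f f.
Proof.
rewrite /energy !pair_big_dep /=.
pose lift_edge (p : G * G) := (lift_end p.1 p.2, lift_end p.2 p.1).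
rewrite (reindex lift_edge) /lift_edge /=; last first.
  exists (fun q => (fold q.1, fold q.2)) => [[u v] _|[a b] ab] /=.
    by rewrite !lift_endK.
  by rewrite !lift_end_fold // adj_sym.
apply: eq_big => [[u v]|[u v] _] /=; last by rewrite !ffunE !lift_endK.
apply/idP/idP => [/fold_adj|/lift_end_adj //]; by rewrite !lift_endK.
Qed.

(** Every vertex [u] is counted at least once, at [lift_end u u]. *)
Lemma hdot_pullback f : hdot f f <= hdot (pullback f) (pullback f).
Proof.
rewrite /hdot [leRHS](partition_big fold xpredT) //=; apply: ler_sum => u _.
rewrite (bigD1 (lift_end u u)) ?lift_endK //= ffunE lift_endK lerDl.
by apply: sumr_ge0 => a _; exact: mul_conjC_ge0.
Qed.

Lemma lambda1_push (x0 : G) s :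
  magnetic_potential s -> lambda1 s <= lambda1 (push_potential s).
Proof.
move=> s_pot; have t_pot := push_potentialP s_pot.
apply: (lambda1_greatest t_pot x0) => f.
apply: (@le_trans _ _ ((lambda1 s)%:C%C * hdot (pullback f) (pullback f))).
  (* The norm of the pullback may exceed that of [f], so the sign of [lambda1 s]
     matters. *)
  by rewrite ler_wpM2l ?hdot_pullback // ler0c lambda1_ge0.
apply: le_trans (lambda1_rayleigh s_pot _) _.
by rewrite -(ler_pMn2r (ltn0Sn 1)) !hdot_laplacian // energy_pullback.
Qed.

(** The constant potential 1 makes the supremum for [H] one over a nonempty
    set, and the degree of [x0] bounds the one for [G]. *)
Theorem magneto_spectral_height_fold (x0 : G) :
  magneto_spectral_height R H <= magneto_spectral_height R G.
Proof.
apply: ge_sup => [|_ [s s_pot <-]].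
  exists (lambda1 (fun _ _ : H => 1 : R[i])), (fun _ _ => 1) => // a b _.
  by rewrite normr1 invr1.
apply: le_trans (lambda1_push x0 s_pot) _; apply: ub_le_sup.
  by exists (degree x0)%:R => _ [t t_pot <-]; apply: lambda1_le_degree.
by exists (push_potential s) => //; apply: push_potentialP.
Qed.

End Folding.

(** * Gluing the two copies of a split vertex *)

Section Unsplit.
Variables (G : graph) (x : G) (N1 N2 : {set G}).
Hypothesis N12 : N1 :|: N2 = neighbours x.
Hypothesis N1I2 : N1 :&: N2 = finset.set0.

Definition unsplit (a : split_vertex x) : G :=
  match a with inl u => val u | inr _ => x end.

(** The end over [u] of the edge that lifts [u v]: when [u] is [x], the copy of
    [x] is determined by the neighbour [v], as [N1] and [N2] partition the
    neighbours of [x]. *)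
Definition split_end (u v : G) : split_vertex x :=
  if insub u is Some u' then inl u' else inr (v \in N1).

Lemma unsplitK u v : unsplit (split_end u v) = u.
Proof.
rewrite /split_end; case: insubP => [u' _ //|]; by rewrite negbK => /eqP.
Qed.

Lemma split_end_vertex v : split_end x v = inr (v \in N1).
Proof. by rewrite /split_end insubF ?eqxx. Qed.

Lemma split_end_val (u : {u : G | u != x}) v : split_end (val u) v = inl u.
Proof. by rewrite /split_end valK. Qed.

Lemma split_nbhd_adj b v : v \in split_nbhd N1 N2 b -> adj x v.
Proof.
by case: b => vN; have := finset.in_setU v N1 N2; rewrite N12 inE vN ?orbT.
Qed.

Lemma split_nbhd_mem b v : v \in split_nbhd N1 N2 b -> (v \in N1) = b.
Proof.
case: b => //= vN2; apply/negP => vN1.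
by have := finset.in_set0 v; rewrite -N1I2 inE vN1 vN2.
Qed.

Lemma unsplit_adj (a b : split_graph x N1 N2) :
  adj a b -> adj (unsplit a) (unsplit b).
Proof.
case: a b => [u|b] [v|c] //=; last exact: split_nbhd_adj.
by rewrite adj_sym; exact: split_nbhd_adj.
Qed.

Lemma split_end_unsplit (a b : split_graph x N1 N2) :
  adj a b -> split_end (unsplit a) (unsplit b) = a.
Proof.
case: a b => [u|b] [v|c] //= ab; rewrite ?split_end_val //.
by rewrite split_end_vertex (split_nbhd_mem ab).
Qed.

Lemma split_end_adj (u v : G) :
  adj u v -> @adj (split_graph x N1 N2) (split_end u v) (split_end v u).
Proof.
have nbhdx w : adj x w -> w \in split_nbhd N1 N2 (w \in N1).
  move=> xw; have := finset.in_setU w N1 N2; rewrite N12 inE xw.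
  by rewrite /split_nbhd; case: ifP => [//|_ /= <-].
have away w : w != x -> exists w' : {w : G | w != x}, w = val w'.
  by move=> wx; exists (Sub w wx).
have [->|/away[u' ->]] := eqVneq u x; have [->|/away[v' ->]] := eqVneq v x.
- by rewrite adj_irr.
- by rewrite split_end_vertex split_end_val => /nbhdx.
- by rewrite adj_sym split_end_vertex split_end_val => /nbhdx.
- by rewrite !split_end_val.
Qed.

End Unsplit.

Theorem lemma4p5 (R : realType) (G : graph) (x : G) (d1 d2 : nat)
    (N1 N2 : {set G}) :
  degree x = (d1 + d2)%N ->
  N1 :|: N2 = neighbours x -> N1 :&: N2 = finset.set0 ->
  #|N1| = d1 -> #|N2| = d2 ->
  magneto_spectral_height R (split_graph x N1 N2)
    <= magneto_spectral_height R G.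
Proof.
move=> _ N12 N1I2 _ _; exact: (@magneto_spectral_height_fold R
  (split_graph x N1 N2) G (@unsplit G x) (@split_end G x N1)
  (@unsplitK G x N1) (unsplit_adj N12) (split_end_unsplit N1I2)
  (split_end_adj N12) x).
Qed.
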